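(* If $G$ is an invertible bipartite graph with a unique perfect matching, then $G^{++}=G$.
   Context: Graphs are finite, may have multiple edges between distinct vertices, and have no loops. A perfect matching is a set of edges covering each vertex exactly once (so edges of a unique perfect matching have no parallel copies). A signing matrix is a diagonal matrix with all diagonal entries $\pm1$; a matrix $X$ is signable to $Y$ if $Y=SXS$ for some signing matrix $S$. $|X|$ denotes the componentwise absolute value. A graph $G$ is invertible if there is a graph $H$ such that $G$ and $H$ possess adjacency matrices $A_G$, $A_H$ with $A_H$ signable to $A_G^{-1}$. Let $G$ be bipartite on $2n$ vertices with a unique perfect matching. Its vertices can be labelled $1,\dots,2n$ so that the matching consists of the edges $\{i,n+i\}$, $\{1,\dots,n\}$ and $\{n+1,\dots,2n\}$ are the two colour classes, and every non-matching edge joins some $i$ to some $n+j$ with $1\le i<j\le n$. Then the adjacency matrix is $A=\begin{pmatrix}0&B\\ B^T&0\end{pmatrix}$ with $B$ upper unitriangular, and $A$ is invertible over the integers. $G^+$ is the graph on the same vertex set with adjacency matrix $A^+=\begin{pmatrix}0&|(B^T)^{-1}|\\ |B^{-1}|&0\end{pmatrix}=|A^{-1}|$. The graph $G^+$ is again bipartite with a unique perfect matching, and $G^{++}=(G^+)^+$, i.e. the graph on the same vertex set with adjacency matrix $\bigl|\,|A^{-1}|^{-1}\bigr|$. *)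

(* Defs.v *)
From HB Require Import structures.
From mathcomp Require Import all_boot all_order all_fingroup all_algebra.

Set Implicit Arguments.
Unset Strict Implicit.
Unset Printing Implicit Defensive.

Import GRing.Theory Num.Theory.
Local Open Scope ring_scope.

(* A finite loopless multigraph on V is given by the multiplicity of each     *)
(* set of vertices as a set of ends; only two-element sets carry edges. With  *)
(* this encoding, Leibniz equality of multigraphs on V is equality of all     *)
(* edge multiplicities.                                                       *)
Record mgraph (V : finType) := MGraph {
  mult : {ffun {set V} -> nat};
  mult_loopless : [forall A : {set V}, (#|A| != 2%N) ==> (mult A == 0%N)] }.

Section Graphs.
Variable V : finType.
Implicit Types G : mgraph V.

(* Parallel edges are distinct: the second component tells them apart. *)
Definition edge G := {A : {set V} & 'I_(mult G A)}.

Definition ends G (e : edge G) : {set V} := tag e.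

Definition perfect_matching G (M : {set edge G}) : Prop :=
  forall v : V, #|[set e in M | v \in ends e]| = 1%N.

Definition has_unique_perfect_matching G : Prop :=
  exists! M : {set edge G}, perfect_matching M.

Definition bipartite G : Prop :=
  exists X : {set V},
    forall e : edge G, #|ends e :&: X| = 1%N /\ #|ends e :&: ~: X| = 1%N.

Definition adjmx G (m : nat) (s : 'I_m -> V) : 'M[int]_m :=
  \matrix_(i, j) (mult G [set s i; s j])%:Z.

End Graphs.

Definition signing_mx (m : nat) (S : 'M[int]_m) : Prop :=
  is_diag_mx S /\ forall i, S i i = 1 \/ S i i = -1.

Definition signable (m : nat) (X Y : 'M[int]_m) : Prop :=
  exists S : 'M[int]_m, signing_mx S /\ Y = S *m X *m S.

(* The entries of a matrix signable to the inverse of A_G are, up to sign,    *)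
(* those of that inverse, which is therefore an integer matrix: invertibility *)
(* over int loses nothing with respect to invertibility over rat.             *)
Definition invertible (V : finType) (G : mgraph V) : Prop :=
  exists (W : finType) (H : mgraph W) (m : nat) (s : 'I_m -> V) (t : 'I_m -> W),
    [/\ bijective s, bijective t, adjmx G s \in unitmx
      & signable (adjmx H t) (invmx (adjmx G s))].

Section GraphOf.
Variables (V : finType) (w : V -> V -> nat).

Definition mult_of (A : {set V}) : nat :=
  if [pick p : V * V | (p.1 != p.2) && (A == [set p.1; p.2])] is Some p
  then w p.1 p.2 else 0%N.

Fact mult_of_loopless :
  [forall A : {set V}, (#|A| != 2%N) ==> ([ffun B => mult_of B] A == 0%N)].
Proof.
apply/forallP => A; apply/implyP; rewrite ffunE /mult_of.
by case: pickP => // p /andP[np /eqP ->]; rewrite cards2 np.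
Qed.

(* The multigraph with w x y edges between x and y, for symmetric w. *)
Definition mgraph_of : mgraph V := MGraph mult_of_loopless.

Lemma mult_mgraph_of x y : (forall x y, w x y = w y x) -> x != y ->
  mult mgraph_of [set x; y] = w x y.
Proof.
move=> wC nxy; rewrite /= ffunE /mult_of; case: pickP => [[a b]|/(_ (x, y))] /=.
  case/andP=> nab /eqP E.
  have: a \in [set x; y] by rewrite E !inE eqxx.
  have: b \in [set x; y] by rewrite E !inE eqxx orbT.
  by move: nab; rewrite !inE => nab /orP[]/eqP ? /orP[]/eqP ?; subst=> //;
    rewrite eqxx in nab.
by rewrite nxy eqxx.
Qed.

End GraphOf.

(* G^+, the graph on V with adjacency matrix |A^-1|. The canonical            *)
(* enumeration of V serves as labelling; adjmx_plus shows that it is          *)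
(* immaterial. Recall that invmx A is junk unless A \in unitmx; the adjacency *)
(* matrix of a bipartite graph with a unique perfect matching is a unit.      *)
Definition plus (V : finType) (G : mgraph V) : mgraph V :=
  mgraph_of (fun x y =>
    `|invmx (adjmx G (@enum_val V predT)) (enum_rank x) (enum_rank y)|%N).

Section PlusTheory.
Variable V : finType.
Implicit Types G : mgraph V.

Lemma mult_gt0_card2 G A : (0 < mult G A)%N -> #|A| = 2%N.
Proof.
move=> h; apply/eqP; apply: contraLR h => nA.
by rewrite -eqn0Ngt; apply: (implyP (forallP (mult_loopless G) A)).
Qed.

Lemma adjmx_sym G m (s : 'I_m -> V) : (adjmx G s)^T = adjmx G s.
Proof. by apply/matrixP => i j; rewrite !mxE setUC. Qed.

Lemma invmx_adjmx_diag G m (s : 'I_m -> V) i :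
  bipartite G -> invmx (adjmx G s) i i = 0.
Proof.
case=> X GX; set A := adjmx G s.
case uA: (A \in unitmx); last first.
  rewrite /invmx uA mxE setUid; apply/eqP; rewrite eqz_nat -leqn0 leqNgt.
  by apply/negP => /mult_gt0_card2; rewrite cards1.
pose D : 'M[int]_m := diag_mx (\row_k (if s k \in X then 1 else -1)).
have DD : D *m D = 1%:M.
  rewrite mulmx_diag -diag_const_mx; congr diag_mx; apply/rowP => k.
  by rewrite !mxE; case: ifP; rewrite ?mulrNN mulr1.
have DA : D *m A *m D = - A.
  apply/matrixP => k l; rewrite mul_mx_diag mul_diag_mx !mxE.
  case: (posnP (mult G [set s k; s l])) => [->|h].
    by rewrite !(mul0r, mulr0, oppr0).
  have [] := GX (existT _ [set s k; s l] (Ordinal h)); rewrite /ends /=.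
  have nkl : s k != s l.
    by have := mult_gt0_card2 h; rewrite cards2; case: eqP.
  rewrite !setIUl !(setIC [set _]).
  case: ifP => kX; case: ifP => lX h1 h2; rewrite ?(mul1r, mulr1, mulN1r, mulrN1) //.
  - suff E : [set s k; s l] :&: X = [set s k; s l].
      by move: h1; rewrite !(setIC X) -setIUl E cards2 nkl.
    by apply/setIidPl/subsetP => z; rewrite !inE => /orP[]/eqP->.
  - suff E : [set s k; s l] :&: ~: X = [set s k; s l].
      by move: h2; rewrite !(setIC (~: X)) -setIUl E cards2 nkl.
    by apply/setIidPl/subsetP => z; rewrite !inE => /orP[]/eqP->; rewrite ?kX ?lX.
have DB : D *m invmx A *m D = - invmx A.
  have E : (- (D *m invmx A *m D)) *m A = 1%:M.
    rewrite -[X in _ *m X]opprK -DA mulNmx mulmxN opprK.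
    rewrite !mulmxA -[_ *m D *m D]mulmxA DD mulmx1 -[_ *m _ *m A]mulmxA.
    by rewrite mulVmx // mulmx1.
  apply: oppr_inj; rewrite opprK; apply: (can_inj (mulmxK uA)).
  by rewrite E mulVmx.
have := congr1 (fun M : 'M[int]_m => M i i) DB.
rewrite mul_mx_diag mul_diag_mx !mxE; set b := invmx A i i.
by case: ifP => _; rewrite ?(mul1r, mulr1, mulN1r, mulrN1, opprK) => /eqP;
  rewrite -subr_eq0 opprK -mulr2n mulrn_eq0 => /eqP.
Qed.

Lemma invmx_adjmx_relabel G (s : 'I_#|V| -> V) : bijective s ->
  invmx (adjmx G s) =
  \matrix_(i, j)
    invmx (adjmx G (@enum_val V predT)) (enum_rank (s i)) (enum_rank (s j)).
Proof.
move=> /bij_inj s_inj; set A := adjmx G (@enum_val V predT).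
pose p : 'S_#|V| := perm (inj_comp enum_rank_inj s_inj).
have pE i : p i = enum_rank (s i) by rewrite permE.
have AE : adjmx G s = perm_mx p *m A *m perm_mx p^-1.
  rewrite -row_permE -col_permE; apply/matrixP => i j.
  by rewrite !mxE !pE !enum_rankK.
have -> : (\matrix_(i, j) invmx A (enum_rank (s i)) (enum_rank (s j)))
   = perm_mx p *m invmx A *m perm_mx p^-1.
  rewrite -row_permE -col_permE; apply/matrixP => i j.
  by rewrite !mxE !pE.
have pV : perm_mx p^-1 *m perm_mx p = 1%:M :> 'M[int]_#|V|.
  by rewrite -perm_mxM mulVg perm_mx1.
case uA: (A \in unitmx); last first.
  by rewrite AE /invmx !unitmx_mul uA andbF.
have uAs : adjmx G s \in unitmx by rewrite AE !unitmx_mul !unitmx_perm uA.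
apply: (can_inj (mulmxK uAs)); rewrite mulVmx // AE !mulmxA.
rewrite -[_ *m perm_mx p^-1 *m perm_mx p]mulmxA pV mulmx1.
by rewrite -[_ *m _ *m A]mulmxA mulVmx // mulmx1 -perm_mxM mulgV perm_mx1.
Qed.

Lemma adjmx_plus G m (s : 'I_m -> V) : bipartite G -> bijective s ->
  adjmx (plus G) s = map_mx Num.norm (invmx (adjmx G s)).
Proof.
move=> bG bs.
have em : m = #|V| by rewrite -(bij_eq_card bs) card_ord.
subst m; apply/matrixP => i j; rewrite [LHS]mxE [RHS]mxE.
have [->|nij] := eqVneq i j.
  rewrite invmx_adjmx_diag // normr0; apply/eqP.
  rewrite setUid eqz_nat -leqn0 leqNgt.
  by apply/negP => /mult_gt0_card2; rewrite cards1.
rewrite mult_mgraph_of; last by rewrite (inj_eq (bij_inj bs)).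
  by rewrite invmx_adjmx_relabel // mxE abszE.
by move=> x y; rewrite -[in RHS](adjmx_sym G) -trmx_inv mxE.
Qed.

End PlusTheory.

(* Main.v *)
Require Import Defs.
From mathcomp Require Import all_boot all_order all_algebra.

(** If the inverse of the adjacency matrix [A] of [G] is [S *m B *m S] with [B]
    the adjacency matrix of a graph and [S] a signing matrix, then taking
    absolute values erases the signs ([norm_signing_conj]), and, [B] being
    nonnegative, [|A^-1| = B].  So [B] is also the adjacency matrix of [G^+].
    As [S] is an involution, [B^-1 = S *m A *m S] ([invmx_signing_conj]), whence
    [|B^-1| = A] by the same argument: [G^++] and [G] have the same adjacency
    matrix, hence are equal ([adjmx_inj]).

    Passing from [G] to the adjacency matrix of [G^+] requires that [A^-1] have
    a zero diagonal ([adjmx_plus_diag0]).  At both steps this holds because the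
    inverse is, up to signs, the adjacency matrix of a loopless graph. *)

Set Implicit Arguments.
Unset Strict Implicit.
Unset Printing Implicit Defensive.

Import GRing.Theory Num.Theory.
Local Open Scope ring_scope.

(** * Signing matrices *)

Section Signing.
Variables (m : nat) (S : 'M[int]_m).
Hypothesis sgS : signing_mx S.

Lemma signing_conjE (X : 'M[int]_m) i j :
  (S *m X *m S) i j = S i i * X i j * S j j.
Proof.
have /is_diag_mxP dS := sgS.1.
rewrite mxE (bigD1 j) //= big1 => [|k nkj]; last by rewrite dS // mulr0.
rewrite addr0 mxE (bigD1 i) //= big1 => [|k nki]; first by rewrite addr0.
by rewrite dS ?mul0r // eq_sym.
Qed.

Lemma norm_signing_diag i : `|S i i| = 1.
Proof. by case: (sgS.2 i) => ->; rewrite ?normrN normr1. Qed.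

Lemma norm_signing_conj (X : 'M[int]_m) :
  map_mx Num.norm (S *m X *m S) = map_mx Num.norm X.
Proof.
apply/matrixP => i j.
by rewrite [LHS]mxE [RHS]mxE signing_conjE !normrM !norm_signing_diag mul1r mulr1.
Qed.

Lemma signing_mxK : S *m S = 1%:M.
Proof.
have /is_diag_mxP dS := sgS.1.
apply/matrixP => i j; rewrite -{1}[S]mulmx1 signing_conjE !mxE.
have [<-|_] := eqVneq i j; last by rewrite mulr0 mul0r.
by rewrite mulr1; case: (sgS.2 i) => ->; rewrite ?mulrNN mulr1.
Qed.

(** Conjugation by the involution [S] commutes with inversion, so a signing
    relation between [A^-1] and [B] also relates [B^-1] and [A]. *)
Lemma invmx_signing_conj (A B : 'M[int]_m) :
  A \in unitmx -> invmx A = S *m B *m S -> invmx B = S *m A *m S.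
Proof.
move=> uA EA.
have BE : B = S *m invmx A *m S.
  by rewrite EA !mulmxA signing_mxK mul1mx -mulmxA signing_mxK mulmx1.
have BV : B *m (S *m A *m S) = 1%:M.
  rewrite BE !mulmxA -[_ *m S *m S]mulmxA signing_mxK mulmx1.
  by rewrite -[_ *m _ *m A]mulmxA mulVmx // mulmx1 signing_mxK.
have [uB _] := mulmx1_unit BV.
by apply: (can_inj (mulKmx uB)); rewrite mulmxV.
Qed.

End Signing.

(** * Graphs and their adjacency matrices *)

Section Adjacency.
Variable V : finType.
Implicit Types G : mgraph V.

Lemma adjmx_diag G m (s : 'I_m -> V) i : adjmx G s i i = 0.
Proof.
rewrite mxE setUid; apply/eqP; rewrite eqz_nat -leqn0 leqNgt.
by apply/negP => /mult_gt0_card2; rewrite cards1.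
Qed.

Lemma norm_adjmx G m (s : 'I_m -> V) :
  map_mx Num.norm (adjmx G s) = adjmx G s.
Proof. by apply/matrixP => i j; rewrite !mxE ger0_norm. Qed.

Lemma adjmx_inj G1 G2 m (s : 'I_m -> V) : bijective s ->
  adjmx G1 s = adjmx G2 s -> G1 = G2.
Proof.
case=> r _ rK E.
have EM : mult G1 = mult G2.
  apply/ffunP => A; have [/cards2P[x [y [_ ->]]]|nA] := boolP (#|A| == 2%N).
    by move/matrixP/(_ (r x) (r y)): E; rewrite !mxE !rK => -[].
  have mult0 G : mult G A = 0%N.
    by apply/eqP; apply: (implyP (forallP (mult_loopless G) A)).
  by rewrite !mult0.
case: G1 G2 EM {E} => [f lf] [g lg] /= EM; subst g.
by congr MGraph; apply: bool_irrelevance.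
Qed.

(** A variant of [adjmx_plus] that applies to [G^+] as well, without first
    showing that [G^+] is bipartite: a zero diagonal of the inverse is what makes
    its absolute value the adjacency matrix of a loopless graph. *)
Lemma adjmx_plus_diag0 G m (s : 'I_m -> V) : bijective s ->
  (forall i, invmx (adjmx G s) i i = 0) ->
  adjmx (plus G) s = map_mx Num.norm (invmx (adjmx G s)).
Proof.
move=> bs d0; have em : m = #|V| by rewrite -(bij_eq_card bs) card_ord.
subst m; apply/matrixP => i j; rewrite [RHS]mxE.
have [->|nij] := eqVneq i j; first by rewrite adjmx_diag d0 normr0.
rewrite mxE mult_mgraph_of; last by rewrite (inj_eq (bij_inj bs)).
  by rewrite invmx_adjmx_relabel // mxE abszE.
by move=> x y; rewrite -[in RHS](adjmx_sym G) -trmx_inv mxE.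
Qed.

End Adjacency.

(** Both steps of the theorem are instances: first [H] is an inverse graph of
    [G], on its own vertex set, then [G^+] takes the place of [G] and [G] that
    of [H]. *)
Lemma adjmx_plus_signed (V W : finType) (G : mgraph V) (H : mgraph W) m
    (s : 'I_m -> V) (t : 'I_m -> W) (S : 'M[int]_m) :
  bijective s -> signing_mx S ->
  invmx (adjmx G s) = S *m adjmx H t *m S -> adjmx (plus G) s = adjmx H t.
Proof.
move=> bs sgS E; rewrite adjmx_plus_diag0 // E.
  by rewrite norm_signing_conj // norm_adjmx.
by move=> i; rewrite signing_conjE // adjmx_diag mulr0 mul0r.
Qed.

Theorem theorem2p9 (V : finType) (G : mgraph V) :
  bipartite G -> has_unique_perfect_matching G -> invertible G ->
  plus (plus G) = G.
Proof.
move=> _ _ [W [H [m [s [t [bs _ uA [S [sgS E]]]]]]]].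
apply: (adjmx_inj bs); apply: (adjmx_plus_signed bs sgS).
by rewrite (adjmx_plus_signed bs sgS E); apply: invmx_signing_conj E.
Qed.
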